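(* Let $\mathcal{A}$ be a finite alphabet and let $u, v \in \mathcal{A}^*$ be two finite words satisfying $$u \neq \widetilde{v}, \qquad u, v \text{ are rich}, \qquad \operatorname{lps}(u) = \operatorname{lpp}(v), \qquad \operatorname{lps}(v) = \operatorname{lpp}(u).$$ If a finite word $w \in \mathcal{A}^*$ contains both $u$ and $v$ as factors, then $w$ is not rich.
   Context: Let $\mathcal{A}$ be a finite set (alphabet) and $\mathcal{A}^*$ the set of all finite words over $\mathcal{A}$, including the empty word; $|w|$ denotes the length of $w$. A word $f$ is a factor of $w$ if $w = pfs$ for some (possibly empty) words $p, s$; such $p$ is called a prefix and $s$ a suffix of $w$ (so prefixes and suffixes may be empty or equal to the whole word). The reversal of $w = w_0 w_1 \cdots w_{n-1}$ is $\widetilde{w} = w_{n-1} \cdots w_1 w_0$, and $w$ is a palindrome if $w = \widetilde{w}$ (the empty word is a palindrome). A finite word $w$ of length $n$ has at most $n+1$ distinct palindromic factors (counting the empty word); its palindromic defect $D(w)$ is $n+1$ minus the number of distinct palindromic factors of $w$ (the empty word included), and $w$ is called rich if $D(w) = 0$. For a finite word $w$, $\operatorname{lps}(w)$ denotes the longest palindromic suffix of $w$ and $\operatorname{lpp}(w)$ denotes the longest palindromic prefix of $w$. *)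

(* Defs.v *)
From mathcomp Require Import all_boot.

Set Implicit Arguments.
Unset Strict Implicit.
Unset Printing Implicit Defensive.

Section Words.

Variable A : finType.
Implicit Types f p u v w : seq A.

Definition palindrome w : bool := w == rev w.

(* Listed with repetitions: the factor of length j starting at position i, for
   all i, j <= size w. *)
Definition factors w : seq (seq A) :=
  [seq take j (drop i w) | i <- iota 0 (size w).+1, j <- iota 0 (size w).+1].

Definition pal_factors w : seq (seq A) :=
  undup [seq f <- factors w | palindrome f].

(* The subtraction is truncated in nat, but never actually truncates: see
   size_pal_factors below. *)
Definition defect w : nat := (size w).+1 - size (pal_factors w).

Definition rich w : bool := defect w == 0.

Definition lpp w : seq A :=
  take (\max_(i < (size w).+1 | palindrome (take i w)) i) w.

Definition lps w : seq A :=
  drop (size w - \max_(i < (size w).+1 | palindrome (drop (size w - i) w)) i) w.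

Lemma mem_factors f w : (f \in factors w) = infix f w.
Proof.
apply/allpairsP/infixP => [[[i j] [_ _ ->]]|[p [s def_w]]].
  exists (take i w), (drop j (drop i w)).
  by rewrite /= !cat_take_drop.
exists (size p, size f); rewrite !mem_iota /= !add0n !ltnS def_w !size_cat.
rewrite leq_addr addnCA leq_addr; split=> //.
by rewrite drop_size_cat // take_size_cat.
Qed.

Lemma mem_pal_factors f w : (f \in pal_factors w) = palindrome f && infix f w.
Proof. by rewrite mem_undup mem_filter mem_factors. Qed.

Lemma lppP w :
  [/\ prefix (lpp w) w, palindrome (lpp w)
    & forall f, prefix f w -> palindrome f -> size f <= size (lpp w)].
Proof.
pose P (i : 'I_(size w).+1) := palindrome (take i w).
have P0 : P ord0 by rewrite /P take0.
have [i Pi def_i] := eq_bigmax_cond (fun i : 'I__ => i : nat)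
  (introT card_gt0P (ex_intro (fun i => i \in P) ord0 P0)).
have def_lpp : lpp w = take i w by rewrite -def_i.
rewrite def_lpp; split=> //; first exact: prefix_take.
move=> f pre_f pal_f; have lt_f := size_prefix pre_f.
rewrite size_takel -1?ltnS // -def_i.
apply: (leq_bigmax_cond (F := fun i : 'I__ => i : nat) (Ordinal (n := (size w).+1) lt_f)).
by rewrite unfold_in /P /=; move: pre_f; rewrite prefixE => /eqP->.
Qed.

Lemma lpsP w :
  [/\ suffix (lps w) w, palindrome (lps w)
    & forall f, suffix f w -> palindrome f -> size f <= size (lps w)].
Proof.
pose P (i : 'I_(size w).+1) := palindrome (drop (size w - i) w).
have P0 : P ord0 by rewrite /P subn0 drop_size.
have [i Pi def_i] := eq_bigmax_cond (fun i : 'I__ => i : nat)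
  (introT card_gt0P (ex_intro (fun i => i \in P) ord0 P0)).
have def_lps : lps w = drop (size w - i) w by rewrite -def_i.
rewrite def_lps; split=> //; first exact: suffix_drop.
move=> f suf_f pal_f; have lt_f := size_suffix suf_f.
rewrite size_drop subKn -1?ltnS // -def_i.
apply: (leq_bigmax_cond (F := fun i : 'I__ => i : nat) (Ordinal (n := (size w).+1) lt_f)).
by rewrite unfold_in /P /=; move: suf_f; rewrite suffixE => /eqP->.
Qed.

Lemma size_pal_factors w : size (pal_factors w) <= (size w).+1.
Proof.
elim/last_ind: w => [//|w a IHw].
rewrite size_rcons; apply: (@leq_trans (size (lps (rcons w a) :: pal_factors w))).
  2: by rewrite /= ltnS.
apply: uniq_leq_size; first exact: undup_uniq.
have [/suffixP[q def_w] /eqP pal_p max_p] := lpsP (rcons w a).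
set p := lps _ in def_w pal_p max_p *.
move=> f; rewrite mem_pal_factors in_cons mem_pal_factors => /andP[pal_f].
rewrite pal_f /= => /infixP[x [y def_f]].
case: (lastP y) def_f => [|y' b] def_f; last first.
  move: def_f; rewrite -!rcons_cat => /rcons_inj[-> _].
  by apply/orP; right; apply: infix_infix.
have suf_f : suffix f (rcons w a) by rewrite def_f cats0 suffix_suffix.
have le_fp := max_p f suf_f pal_f.
have suf_fp : suffix f p.
  by move: suf_f; rewrite def_w !suffixE drop_cat size_cat -addnBA // ltnNge
    leq_addr /= addKn.
have: prefix f p by move: suf_fp; rewrite /suffix -(eqP pal_f) -pal_p.
case/prefixP=> t; case: (lastP t) => [|t' b] def_p.
  by rewrite def_p cats0 eqxx.
move: def_w; rewrite def_p -!rcons_cat => /rcons_inj[-> _].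
by apply/orP; right; apply: infix_infix.
Qed.

End Words.

(* Main.v *)
Require Import Defs.
From mathcomp Require Import all_boot.

(** The theorem follows from a rigidity property of a rich word [w]: a factor
    of [w] is determined, up to reversal, by the unordered pair formed by its
    longest palindromic prefix and suffix ([rich_ends_inj]).  The hypotheses
    say that [u] and [v] have the same pair, so a rich [w] containing both
    forces [v = u] or [v = rev u]; in the first case [lpp u = lps u], which
    makes the rich word [u] a palindrome, so that [u = rev v] either way.

    Removing the first letter of a word destroys at most one palindromic
    factor, the longest palindromic prefix.  Hence richness passes to the
    shorter word, and the longest palindromic prefix of a rich word occurs only
    as a prefix ([rich_lpp_once]); symmetrically for suffixes.

    Rigidity is proved by induction on [w], for two factors [x] and [y] with the
    same pair of ends.  If [x] is a prefix of [w] shorter than [P = lpp w],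
    reflecting it inside the palindrome [P] shows that [rev x] occurs in [w]
    without its first letter.  So, up to reversal, [x] survives the deletion of
    the first letter unless [x] is a prefix with [lpp x = lpp w]; likewise for
    [y] and for the last letter.  If one of the two deletions spares both words,
    induction applies.  Otherwise one of the words is a prefix sharing its [lpp]
    with [w], one is a suffix sharing its [lps] with [w], and since these
    palindromes occur only once in [w], both words are [w] itself. *)

(** * Longest palindromic prefixes and suffixes under reversal *)

Lemma prefix_prefix {T : eqType} {f g w : seq T} :
  prefix f w -> prefix g w -> size f <= size g -> prefix f g.
Proof.
rewrite !prefixE => /eqP def_f /eqP def_g le_fg.
by rewrite -def_g take_takel // def_f.
Qed.

Section RichWords.

Set Implicit Arguments.
Unset Strict Implicit.

Variable A : finType.
Implicit Types f p u v w x y : seq A.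

Lemma lpp_max w p :
  prefix p w -> palindrome p ->
  (forall f, prefix f w -> palindrome f -> size f <= size p) -> lpp w = p.
Proof.
move=> pre_p pal_p max_p; have [pre_l pal_l max_l] := lppP w.
have eq_size : size (lpp w) = size p.
  by apply/eqP; rewrite eqn_leq max_p // max_l.
by move: pre_p pre_l; rewrite !prefixE eq_size => /eqP {2}<- /eqP <-.
Qed.

Lemma palindrome_rev w : palindrome (rev w) = palindrome w.
Proof. by rewrite /palindrome revK eq_sym. Qed.

Lemma lpp_rev w : lpp (rev w) = lps w.
Proof.
have [suf_l pal_l max_l] := lpsP w.
apply: lpp_max => // [|f]; first by rewrite (eqP pal_l) prefix_rev.
rewrite -suffix_revLR -palindrome_rev -(size_rev f); exact: max_l.
Qed.

Lemma lps_rev w : lps (rev w) = lpp w.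
Proof. by rewrite -lpp_rev revK. Qed.

Lemma palindrome_lpp w : palindrome w -> lpp w = w.
Proof. by move=> pal_w; apply: lpp_max => [|//|f /size_prefix]; first exact: prefix_refl. Qed.

Lemma palindrome_lps w : palindrome w -> lps w = w.
Proof. by move=> pal_w; rewrite -lpp_rev -(eqP pal_w) palindrome_lpp. Qed.

(** Reflecting [x] inside the palindrome [lpp (a :: w)], of which it is a
    proper prefix, yields an occurrence of [rev x] that avoids the first
    letter. *)
Lemma infix_rev_behead a w x :
  prefix x (a :: w) -> size x < size (lpp (a :: w)) -> infix (rev x) w.
Proof.
have [pre_l pal_l _] := lppP (a :: w) => pre_x lt_x.
have /prefixP[t def_l] := prefix_prefix pre_x pre_l (ltnW lt_x).
have /prefixP[r] := pre_l.
rewrite (eqP pal_l) def_l rev_cat.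
case: (lastP t) def_l lt_x => [-> | t' b _ _]; first by rewrite cats0 ltnn.
by rewrite rev_rcons /= -catA => -[_ ->]; rewrite infix_infix.
Qed.

(** * Richness under deletion of a letter and under reversal *)

Lemma richE w : rich w = (size w < size (pal_factors w)).
Proof. by rewrite /rich /defect subn_eq0. Qed.

(** A palindromic factor lost with the first letter is a prefix; if it were
    shorter than the longest one, its mirror image, namely itself, would
    survive. *)
Lemma pal_factors_cons a w :
  {subset pal_factors (a :: w) <= lpp (a :: w) :: pal_factors w}.
Proof.
move=> f; rewrite in_cons !mem_pal_factors infix_consl => /andP[pal_f].
rewrite pal_f => /orP[pre_f|->]; last by rewrite orbT.
have [pre_l _ max_l] := lppP (a :: w).
have := max_l f pre_f pal_f; rewrite leq_eqVlt => /orP[/eqP eq_size | lt_size].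
  by move: pre_f pre_l; rewrite !prefixE eq_size => /eqP-> /eqP->; rewrite eqxx.
by rewrite /= (eqP pal_f) (infix_rev_behead pre_f lt_size) orbT.
Qed.

Lemma rich_behead a w : rich (a :: w) -> rich w.
Proof.
rewrite !richE => rich_aw; rewrite -ltnS; apply: leq_trans rich_aw _.
exact: uniq_leq_size (undup_uniq _) (@pal_factors_cons a w).
Qed.

Lemma rich_rev w : rich (rev w) = rich w.
Proof.
rewrite !richE size_rev; congr (_ < _); apply/perm_size.
apply: uniq_perm; try exact: undup_uniq.
move=> f; rewrite !mem_pal_factors; case pal_f: (palindrome f) => //=.
by rewrite {1}(eqP pal_f) infix_rev.
Qed.

Lemma rich_belast w a : rich (rcons w a) -> rich w.
Proof. by rewrite -rich_rev rev_rcons => /rich_behead; rewrite rich_rev. Qed.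

(** If the longest palindromic prefix occurred again, deleting the first letter
    would destroy no palindromic factor, leaving more palindromic factors than
    the length allows. *)
Lemma rich_lpp_once w s t : rich w -> w = s ++ lpp w ++ t -> s = [::].
Proof.
case: s => // b s rich_w; case: w rich_w => // a w rich_w.
set p := lpp _ => -[_ def_w]; have [_ pal_p _] := lppP (a :: w).
have p_in : p \in pal_factors w.
  by rewrite mem_pal_factors pal_p def_w infix_infix.
move: rich_w; rewrite richE ltnNge => /negP[].
apply: leq_trans (size_pal_factors w).
apply: uniq_leq_size; first exact: undup_uniq.
by move=> f /pal_factors_cons; rewrite in_cons => /orP[/eqP->|].
Qed.

Lemma rich_lps_once w s t : rich w -> w = s ++ lps w ++ t -> t = [::].
Proof.
rewrite -rich_rev => rich_w def_w; apply: (can_inj revK).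
have [_ pal_l _] := lpsP w.
apply: (rich_lpp_once (t := rev s) rich_w).
by rewrite lpp_rev {1}def_w !rev_cat -(eqP pal_l) catA.
Qed.

Lemma rich_lpp_lps w : rich w -> lpp w = lps w -> palindrome w.
Proof.
have [/prefixP[t def_w] pal_l _] := lppP w => rich_w eq_l.
have t0 : t = [::] by apply: (@rich_lps_once w [::] t rich_w); rewrite -eq_l.
by rewrite def_w t0 cats0.
Qed.

(** * The two palindromic ends of a factor *)

(** Compared up to [perm_eq], this list is the unordered pair of ends. *)
Definition ends x := [:: lpp x; lps x].

Lemma ends_rev x : perm_eq (ends (rev x)) (ends x).
Proof. by rewrite /ends lpp_rev lps_rev (perm_catC [:: _] [:: _]). Qed.

Lemma ends_cases x y :
  perm_eq (ends x) (ends y) ->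
  (lpp x = lpp y /\ lps x = lps y) \/ (lpp x = lps y /\ lps x = lpp y).
Proof.
move=> eq_xy; have := perm_mem eq_xy (lpp x).
rewrite /ends !inE eqxx /= => /esym/orP[]/eqP def_x; move: eq_xy.
  by rewrite /ends def_x perm_cons => /perm_small_eq-/(_ isT)[->]; left.
rewrite /ends def_x perm_sym (perm_catC [:: _] [:: _]) perm_cons.
by move=> /perm_small_eq-/(_ isT)[->]; right.
Qed.

(** In a rich word [w] both ends of [w] occur only once, so a factor that has
    them as its own ends is stretched over all of [w]. *)
Lemma rich_ends_eq w x :
  rich w -> infix x w -> perm_eq (ends x) (ends w) -> x = w.
Proof.
move=> rich_w /infixP[s [t def_w]] /ends_cases.
have [/prefixP[x2 def_x2] _ _] := lppP x.
have [/suffixP[x1 def_x1] _ _] := lpsP x.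
case=> -[eq_p eq_s].
  have s0 : s = [::].
    apply: (@rich_lpp_once w s (x2 ++ t) rich_w).
    by rewrite -eq_p catA catA -(catA s) -def_x2 -catA.
  have t0 : t = [::].
    apply: (@rich_lps_once w (s ++ x1) t rich_w).
    by rewrite -eq_s -catA (catA x1) -def_x1.
  by rewrite def_w s0 t0 cats0.
(* The swapped case: the suffix [lps x] of [x] starts [w] and its prefix [lpp x]
   ends [w], so no letter of [w] lies outside [x]. *)
have /eqP : s ++ x1 = [::].
  apply: (@rich_lpp_once w (s ++ x1) t rich_w).
  by rewrite -eq_s -catA (catA x1) -def_x1.
have /eqP : x2 ++ t = [::].
  apply: (@rich_lps_once w s (x2 ++ t) rich_w).
  by rewrite -eq_p catA catA -(catA s) -def_x2 -catA.
rewrite -!size_eq0 !size_cat !addn_eq0 !size_eq0.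
by move=> /andP[_ /eqP t0] /andP[/eqP s0 _]; rewrite def_w s0 t0 cats0.
Qed.

Definition occurs_or_rev x w := infix x w || infix (rev x) w.

Lemma occurs_or_rev_behead a w x :
  infix x (a :: w) ->
  occurs_or_rev x w \/ prefix x (a :: w) /\ lpp x = lpp (a :: w).
Proof.
rewrite infix_consl /occurs_or_rev => /orP[pre_x|->]; last by left.
have [le_l|lt_x] := leqP (size (lpp (a :: w))) (size x); last first.
  by left; rewrite (infix_rev_behead pre_x lt_x) orbT.
right; split=> //; have [pre_l pal_l max_l] := lppP (a :: w).
apply: lpp_max => // [|f pre_f]; first exact: prefix_prefix pre_l pre_x le_l.
by apply: max_l; apply: prefix_trans pre_f pre_x.
Qed.

Lemma occurs_or_rev_belast w a x :
  infix x (rcons w a) ->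
  occurs_or_rev x w \/ suffix x (rcons w a) /\ lps x = lps (rcons w a).
Proof.
rewrite -infix_rev rev_rcons => /occurs_or_rev_behead.
rewrite -rev_rcons !lpp_rev prefix_rev /occurs_or_rev.
by rewrite infix_rev infix_revLR revK.
Qed.

(** The situation in which no deletion spares both words.  The palindrome
    [lps w] is an end of [y], hence of [x]: either it is [lps x], or it is
    [lpp x], and then the two ends of [w] coincide. *)
Lemma rich_prefix_suffix_ends w x y :
  rich w -> perm_eq (ends x) (ends y) ->
  prefix x w -> lpp x = lpp w -> lps y = lps w ->
  perm_eq (ends x) (ends w).
Proof.
move=> rich_w eq_xy pre_x lpp_x lps_y.
case/ends_cases: eq_xy => -[eq1 eq2].
  by rewrite /ends lpp_x eq2 lps_y.
(* Here [lpp w = lps w], so [w] is a palindrome, equal to its prefix [x]. *)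
have pal_w : palindrome w by apply: rich_lpp_lps; rewrite // -lpp_x eq1.
suff -> : x = w by [].
have [pre_l _ _] := lppP x; have := size_prefix pre_l.
rewrite lpp_x palindrome_lpp // => le_wx.
by move: pre_x; rewrite prefixE take_oversize // => /eqP.
Qed.

Lemma occurs_or_revP x w :
  occurs_or_rev x w ->
  exists2 x', infix x' w & (x' = x \/ x' = rev x) /\ perm_eq (ends x') (ends x).
Proof.
case/orP=> x_w; [exists x | exists (rev x)] => //; first by split; [left|].
by split; [right | apply: ends_rev].
Qed.

(** Both the ends and the conclusion being insensitive to reversal, rigidity
    extends from the factors of [w] to words occurring up to reversal. *)
Lemma ends_inj_up_to_rev w x y :
  (forall x' y', infix x' w -> infix y' w -> perm_eq (ends x') (ends y') ->
     y' = x' \/ y' = rev x') ->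
  occurs_or_rev x w -> occurs_or_rev y w -> perm_eq (ends x) (ends y) ->
  y = x \/ y = rev x.
Proof.
move=> inj_w /occurs_or_revP[x' x'_w [def_x' eq_x]].
move=> /occurs_or_revP[y' y'_w [def_y' eq_y]] eq_xy.
have: y' = x' \/ y' = rev x'.
  apply: inj_w => //; apply: perm_trans eq_x _.
  by apply: perm_trans eq_xy _; rewrite perm_sym.
case: def_x' => ->; case: def_y' => ->; rewrite ?revK => -[] def_y.
all: by [left | right | left; apply: (can_inj revK)
        | right; apply: (can_inj revK); rewrite revK].
Qed.

(** Rigidity, by deleting the first or the last letter of [w] until neither
    deletion spares both words. *)
Lemma rich_ends_inj w x y :
  rich w -> infix x w -> infix y w -> perm_eq (ends x) (ends y) ->
  y = x \/ y = rev x.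
Proof.
have [n le_wn] := ubnP (size w).
elim: n => // n IHn in w x y le_wn *; move=> rich_w x_w y_w eq_xy.
have eq_yx : perm_eq (ends y) (ends x) by rewrite perm_sym.
(* If either word has the ends of [w], both are equal to [w]. *)
have full z : z = x \/ z = y -> perm_eq (ends z) (ends w) -> y = x \/ y = rev x.
  move=> def_z eq_zw; left.
  have eq_zx : perm_eq (ends x) (ends z) by case: def_z => ->.
  have eq_zy : perm_eq (ends y) (ends z) by case: def_z => ->.
  rewrite (rich_ends_eq rich_w x_w (perm_trans eq_zx eq_zw)).
  exact: rich_ends_eq rich_w y_w (perm_trans eq_zy eq_zw).
have by_behead a w1 : w = a :: w1 -> occurs_or_rev x w1 -> occurs_or_rev y w1 ->
    y = x \/ y = rev x.
  move=> def_w x_w1 y_w1; apply: (@ends_inj_up_to_rev w1) => // x' y'.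
  by apply: IHn; move: le_wn rich_w; rewrite def_w //; move=> _ /rich_behead.
have by_belast a w1 : w = rcons w1 a -> occurs_or_rev x w1 ->
    occurs_or_rev y w1 -> y = x \/ y = rev x.
  move=> def_w x_w1 y_w1; apply: (@ends_inj_up_to_rev w1) => // x' y'.
  apply: IHn; move: le_wn rich_w; rewrite def_w ?size_rcons //.
  by move=> _ /rich_belast.
have pre_cases : (y = x \/ y = rev x) \/
    exists2 z, z = x \/ z = y & prefix z w /\ lpp z = lpp w.
  case def_w: w => [|a w1].
    by left; left; move: x_w y_w; rewrite def_w !infixs0 => /eqP-> /eqP->.
  have [x_w1|pre_x] : _ \/ _ := @occurs_or_rev_behead a w1 x ltac:(by rewrite -def_w).
    have [y_w1|pre_y] : _ \/ _ := @occurs_or_rev_behead a w1 y ltac:(by rewrite -def_w).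
      by left; apply: by_behead def_w _ _.
    by right; exists y; [right|].
  by right; exists x; [left|].
have suf_cases : (y = x \/ y = rev x) \/
    exists2 z, z = x \/ z = y & suffix z w /\ lps z = lps w.
  have [def_w|[w1 [a def_w]]] : w = [::] \/ exists w1 a, w = rcons w1 a.
    by case/lastP: (w) => [|w1 a]; [left | right; exists w1, a].
  - by left; left; move: x_w y_w; rewrite def_w !infixs0 => /eqP-> /eqP->.
  rewrite def_w.
  have [x_w1|suf_x] : _ \/ _ := @occurs_or_rev_belast w1 a x ltac:(by rewrite -def_w).
    have [y_w1|suf_y] : _ \/ _ := @occurs_or_rev_belast w1 a y ltac:(by rewrite -def_w).
      by left; apply: by_belast def_w _ _.
    by right; exists y; [right|].
  by right; exists x; [left|].
case: pre_cases => [//|[z1 def_z1 [pre_z1 lpp_z1]]].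
case: suf_cases => [//|[z2 def_z2 [_ lps_z2]]].
apply: (full z1) => //; apply: (@rich_prefix_suffix_ends _ _ z2) => //.
by case: def_z1 => ->; case: def_z2 => ->.
Qed.

End RichWords.

Theorem proposition10 (A : finType) (u v : seq A)
  (neq_uv : u <> rev v)
  (rich_u : rich u) (rich_v : rich v)
  (lps_u : lps u = lpp v) (lps_v : lps v = lpp u)
  (w : seq A) (u_in_w : infix u w) (v_in_w : infix v w) :
  ~ rich w.
Proof.
move=> rich_w; apply: neq_uv.
have eq_ends : perm_eq (ends u) (ends v).
  by rewrite -(permPr (ends_rev v)) /ends lpp_rev lps_rev lps_u lps_v.
have [def_v|->] := rich_ends_inj rich_w u_in_w v_in_w eq_ends.
  by rewrite def_v; apply/eqP/rich_lpp_lps; rewrite // lps_u def_v.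
by rewrite revK.
Qed.
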